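(* Let $N$ be a positive integer, $a(k)\in\mathbb{H}$ and $b(k)\in\mathbb{H}\setminus\{0\}$ for $0\le k\le N$, and $h_1,h_2\in\mathbb{H}$. Let $\mathcal{L}$, $\phi(k,\lambda,s)$, $\boldsymbol{\varphi}(\lambda,s)$ and $p_N(\lambda,s)$ be the associated operator and functions defined in the context, and suppose that $\mathcal{L}$ is normal. Let $s\in\mathbb{H}\setminus\{0\}$ and let $f_s(\lambda)=\sum_{k=1}^{N}\overline{F(k)}\,\phi(k,\lambda,s)$ with $F(1),\dots,F(N)\in\mathbb{H}$. If $p_N(\lambda,s)$, as a polynomial in $\lambda$, has at least one spherical zero, then there are infinitely many sampling expansions for $f_s(\lambda)$.
   Context: $\mathbb{H}$ is the skew field of real quaternions, $\overline{q}$ the quaternion conjugate. $\mathbb{H}^N$ is regarded as a right $\mathbb{H}$-module with inner product $\langle\boldsymbol{\xi},\boldsymbol{\eta}\rangle=\boldsymbol{\xi}^*\boldsymbol{\eta}=\sum_k\overline{\xi_k}\eta_k$ and norm $\|\boldsymbol{\xi}\|=\sqrt{\langle\boldsymbol{\xi},\boldsymbol{\xi}\rangle}$. Consider the difference equation $$(E)\quad b(k)x(k+1)+a(k)x(k)+b(k-1)x(k-1)=x(k)\lambda,\quad k=1,2,\dots,N,$$ with parameter $\lambda\in\mathbb{H}$, and the boundary conditions $$(B_1)\quad x(0)+h_1x(1)=0,\qquad (B_2)\quad x(N+1)+h_2x(N)=0.$$ The right $\mathbb{H}$-linear operator $\mathcal{L}$ on $\mathbb{H}^N$ is defined for $\boldsymbol{x}=[x(1),\dots,x(N)]^\top$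 by $(\mathcal{L}\boldsymbol{x})(k)=b(k)x(k+1)+a(k)x(k)+b(k-1)x(k-1)$, $1\le k\le N$, where $x(0):=-h_1x(1)$ and $x(N+1):=-h_2x(N)$. It is normal if $\mathcal{L}\mathcal{L}^*=\mathcal{L}^*\mathcal{L}$, where $\mathcal{L}^*$ is the adjoint with respect to $\langle\cdot,\cdot\rangle$. For $\lambda,s\in\mathbb{H}$, $\phi(k,\lambda,s)$ ($0\le k\le N+1$) denotes the unique solution $x(k)$ of $(E)$ and $(B_1)$ with $x(1)=s$; it is, for $k\ge 1$, a polynomial in $\lambda$ of the form $\sum_j c_j s\lambda^j$ with $c_j\in\mathbb{H}$. Put $\boldsymbol{\varphi}(\lambda,s)=[\phi(1,\lambda,s),\dots,\phi(N,\lambda,s)]^\top$ and $p_N(\lambda,s)=\phi(N+1,\lambda,s)+h_2\phi(N,\lambda,s)$. For $q\in\mathbb{H}$ the similarity orbit is $\theta(q)=\{\alpha^{-1}q\alpha:\alpha\in\mathbb{H}\setminus\{0\}\}$. A zero $z_0$ of a polynomial $p$ is spherical if $z_0\notin\mathbb{R}$ and $p(z)=0$ for all $z\in\theta(z_0)$. A sampling expansion for $f_s$ is a representation, valid for all $\lambda\in\mathbb{H}$, $$f_s(\lambda)=\sum_{k=1}^{N}f_s(\lambda_k)\,\frac{\langle\boldsymbol{\varphi}(\lambda_k,s),\boldsymbol{\varphi}(\lambda,s)\rangle}{\|\boldsymbol{\varphi}(\lambda_k,s)\|^2}$$ with sample points $\lambda_1,\dots,\lambda_N\in\mathbb{H}$;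 two sampling expansions are different if their sets of sample points are different. *)

(* Defs.v *)
From HB Require Import structures.
From mathcomp Require Import all_boot all_order all_algebra.
From mathcomp Require Import boolp classical_sets cardinality reals.
From mathcomp Require Import ring lra.
Set Implicit Arguments.
Unset Strict Implicit.
Unset Printing Implicit Defensive.
Import Order.TTheory GRing.Theory Num.Theory.
Local Open Scope ring_scope.

(* Quat w x y z is w + x i + y j + z k. *)
Record quat (R : realType) : Type := Quat { qre : R; qi : R; qj : R; qk : R }.

Definition quat_tuple (R : realType) (q : quat R) : R * R * R * R :=
  (qre q, qi q, qj q, qk q).
Definition tuple_quat (R : realType) (t : R * R * R * R) : quat R :=
  Quat t.1.1.1 t.1.1.2 t.1.2 t.2.
Lemma quat_tupleK (R : realType) : cancel (@quat_tuple R) (@tuple_quat R).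
Proof. by case. Qed.

HB.instance Definition _ (R : realType) :=
  Choice.copy (quat R) (can_type (@quat_tupleK R)).

Definition qzero (R : realType) : quat R := Quat 0 0 0 0.
Definition qone (R : realType) : quat R := Quat 1 0 0 0.
Definition qopp (R : realType) (p : quat R) : quat R :=
  Quat (- qre p) (- qi p) (- qj p) (- qk p).
Definition qadd (R : realType) (p q : quat R) : quat R :=
  Quat (qre p + qre q) (qi p + qi q) (qj p + qj q) (qk p + qk q).
Definition qmul (R : realType) (p q : quat R) : quat R :=
  Quat (qre p * qre q - qi p * qi q - qj p * qj q - qk p * qk q)
       (qre p * qi q + qi p * qre q + qj p * qk q - qk p * qj q)
       (qre p * qj q - qi p * qk q + qj p * qre q + qk p * qi q)
       (qre p * qk q + qi p * qj q - qj p * qi q + qk p * qre q).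
Definition qconj (R : realType) (p : quat R) : quat R :=
  Quat (qre p) (- qi p) (- qj p) (- qk p).
Definition qnorm2 (R : realType) (p : quat R) : R :=
  qre p ^+ 2 + qi p ^+ 2 + qj p ^+ 2 + qk p ^+ 2.
Definition qinv (R : realType) (p : quat R) : quat R :=
  Quat (qre p / qnorm2 p) (- qi p / qnorm2 p)
       (- qj p / qnorm2 p) (- qk p / qnorm2 p).

Lemma quatP (R : realType) (p q : quat R) :
  qre p = qre q -> qi p = qi q -> qj p = qj q -> qk p = qk q -> p = q.
Proof. by case: p => ? ? ? ?; case: q => ? ? ? ? /= -> -> -> ->. Qed.

Fact qaddA (R : realType) : associative (@qadd R).
Proof. by move=> p q r; apply: quatP; rewrite /= addrA. Qed.
Fact qaddC (R : realType) : commutative (@qadd R).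
Proof. by move=> p q; apply: quatP; rewrite /= addrC. Qed.
Fact qadd0q (R : realType) : left_id (qzero R) (@qadd R).
Proof. by move=> p; apply: quatP; rewrite /= add0r. Qed.
Fact qaddNq (R : realType) : left_inverse (qzero R) (@qopp R) (@qadd R).
Proof. by move=> p; apply: quatP; rewrite /= addNr. Qed.

HB.instance Definition _ (R : realType) :=
  GRing.isZmodule.Build (quat R) (@qaddA R) (@qaddC R) (@qadd0q R) (@qaddNq R).

Fact qmulA (R : realType) : associative (@qmul R).
Proof. by move=> p q r; apply: quatP => /=; ring. Qed.
Fact qmul1q (R : realType) : left_id (qone R) (@qmul R).
Proof. by move=> p; apply: quatP => /=; ring. Qed.
Fact qmulq1 (R : realType) : right_id (qone R) (@qmul R).
Proof. by move=> p; apply: quatP => /=; ring. Qed.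
Fact qmulDl (R : realType) : left_distributive (@qmul R) (@qadd R).
Proof. by move=> p q r; apply: quatP => /=; ring. Qed.
Fact qmulDr (R : realType) : right_distributive (@qmul R) (@qadd R).
Proof. by move=> p q r; apply: quatP => /=; ring. Qed.
Fact qone_neq0 (R : realType) : qone R != 0.
Proof.
by apply/eqP => /(congr1 (@qre R)) /eqP; rewrite (oner_eq0 R).
Qed.

HB.instance Definition _ (R : realType) :=
  GRing.Zmodule_isNzRing.Build (quat R) (@qmulA R) (@qmul1q R) (@qmulq1 R)
    (@qmulDl R) (@qmulDr R) (@qone_neq0 R).

Lemma qnorm2_neq0 (R : realType) (p : quat R) : p != 0 -> qnorm2 p != 0.
Proof.
apply: contraNneq => p0; apply/eqP.
have := sqr_ge0 (qre p); have := sqr_ge0 (qi p).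
have := sqr_ge0 (qj p); have := sqr_ge0 (qk p).
move: p0; rewrite /qnorm2 => p0 h1 h2 h3 h4.
by apply: quatP => /=; apply/eqP; rewrite -sqrf_eq0; apply/eqP; lra.
Qed.

Fact qmulVq (R : realType) :
  {in predC1 (0 : quat R), left_inverse 1 (@qinv R) *%R}.
Proof.
by move=> p /qnorm2_neq0 p0; apply: quatP; move: p0; rewrite /= /qnorm2 => p0;
  field.
Qed.
Fact qmulqV (R : realType) :
  {in predC1 (0 : quat R), right_inverse 1 (@qinv R) *%R}.
Proof.
by move=> p /qnorm2_neq0 p0; apply: quatP; move: p0; rewrite /= /qnorm2 => p0;
  field.
Qed.
Fact qunitP (R : realType) (p q : quat R) :
  q * p = 1 /\ p * q = 1 -> predC1 (0 : quat R) p.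
Proof.
move=> [qp _] /=; apply/eqP => p0; move: qp; rewrite p0 mulr0 => /eqP.
by rewrite eq_sym oner_eq0.
Qed.
Fact qinv_out (R : realType) :
  {in [predC predC1 (0 : quat R)], @qinv R =1 id}.
Proof.
by move=> p; rewrite !inE negbK => /eqP ->; apply: quatP => /=;
  rewrite ?oppr0 mul0r.
Qed.

HB.instance Definition _ (R : realType) :=
  GRing.NzRing_hasMulInverse.Build (quat R) (@qmulVq R) (@qmulqV R)
    (@qunitP R) (@qinv_out R).

Lemma quat_unitE (R : realType) (p : quat R) :
  (p \is a GRing.unit) = (p != 0).
Proof. by []. Qed.

Definition quat_of_real (R : realType) (r : R) : quat R := Quat r 0 0 0.

Definition inner (R : realType) (N : nat) (x y : 'cV[quat R]_N) : quat R :=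
  \sum_(i < N) qconj (x i 0) * y i 0.

Definition vnorm (R : realType) (N : nat) (x : 'cV[quat R]_N) : R :=
  Num.sqrt (qre (inner x x)).

(* Taking the real part in [vnorm] loses nothing. *)
Lemma innerxx (R : realType) (N : nat) (x : 'cV[quat R]_N) :
  inner x x = quat_of_real (\sum_(i < N) qnorm2 (x i 0)).
Proof.
rewrite /inner; elim/big_rec2: _ => [|i s t _ ->]; first exact: quatP.
by apply: quatP; rewrite /= /qnorm2; ring.
Qed.

Definition is_adjoint (R : realType) (N : nat)
    (T Ts : 'cV[quat R]_N -> 'cV[quat R]_N) : Prop :=
  forall x y, inner (T x) y = inner x (Ts y).

Definition normal_op (R : realType) (N : nat)
    (T : 'cV[quat R]_N -> 'cV[quat R]_N) : Prop :=
  exists2 Ts, is_adjoint T Ts & T \o Ts =1 Ts \o T.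

Definition vscale (R : realType) (N : nat) (x : 'cV[quat R]_N) (q : quat R) :
  'cV[quat R]_N := map_mx (fun c => c * q) x.

Definition right_linear (R : realType) (N : nat)
    (T : 'cV[quat R]_N -> 'cV[quat R]_N) : Prop :=
  (forall x y, T (x + y) = T x + T y) /\
  (forall x q, T (vscale x q) = vscale (T x) q).

Lemma qconjM (R : realType) (p q : quat R) : qconj (p * q) = qconj q * qconj p.
Proof. by apply: quatP => /=; ring. Qed.
Lemma qconjD (R : realType) (p q : quat R) : qconj (p + q) = qconj p + qconj q.
Proof. by apply: quatP => /=; ring. Qed.
Lemma qconj0 (R : realType) : qconj (0 : quat R) = 0.
Proof. by apply: quatP => /=; rewrite ?oppr0. Qed.
Lemma qconj1 (R : realType) : qconj (1 : quat R) = 1.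
Proof. by apply: quatP => /=; rewrite ?oppr0. Qed.

Lemma innerDl (R : realType) (N : nat) (x y z : 'cV[quat R]_N) :
  inner (x + y) z = inner x z + inner y z.
Proof.
by rewrite /inner -big_split; apply: eq_bigr => i _;
  rewrite mxE qconjD mulrDl.
Qed.
Lemma inner0l (R : realType) (N : nat) (z : 'cV[quat R]_N) : inner 0 z = 0.
Proof. by rewrite /inner big1 // => i _; rewrite mxE qconj0 mul0r. Qed.
Lemma inner_vscalel (R : realType) (N : nat) (x z : 'cV[quat R]_N) q :
  inner (vscale x q) z = qconj q * inner x z.
Proof.
by rewrite /inner mulr_sumr; apply: eq_bigr => i _; rewrite mxE qconjM mulrA.
Qed.
Lemma inner_delta (R : realType) (N : nat) (i : 'I_N) (y : 'cV[quat R]_N) :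
  inner (delta_mx i 0) y = y i 0.
Proof.
rewrite /inner (bigD1 i) //= big1 => [|j ji].
  by rewrite mxE !eqxx qconj1 mul1r addr0.
by rewrite mxE (negPf ji) qconj0 mul0r.
Qed.

Lemma adjoint_exists (R : realType) (N : nat)
    (T : 'cV[quat R]_N -> 'cV[quat R]_N) :
  right_linear T -> exists Ts, is_adjoint T Ts.
Proof.
move=> [TD TZ].
exists (fun y => \col_i inner (T (delta_mx i 0)) y) => x y.
have T0 : T 0 = 0 by apply: (addrI (T 0)); rewrite -TD !addr0.
have -> : x = \sum_i vscale (delta_mx i 0) (x i 0).
  apply/matrixP => i j; rewrite summxE (bigD1 i) //= big1 => [|k ki].
    by rewrite !mxE (ord1 j) !eqxx mul1r addr0.
  by rewrite !mxE (eq_sym i) (negPf ki) mul0r.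
elim/big_ind: _ => [|u v Hu Hv|i _].
- by rewrite T0 !inner0l.
- by rewrite TD !innerDl Hu Hv.
by rewrite TZ !inner_vscalel inner_delta mxE.
Qed.

Lemma adjoint_unique (R : realType) (N : nat)
    (T T1 T2 : 'cV[quat R]_N -> 'cV[quat R]_N) :
  is_adjoint T T1 -> is_adjoint T T2 -> T1 =1 T2.
Proof.
move=> H1 H2 y; apply/matrixP => i j.
by rewrite (ord1 j) -!inner_delta -H1 -H2.
Qed.

(* Coordinates of a vector are numbered 1, ..., N; the value at any other
   index is irrelevant. *)
Definition vcoord (R : realType) (N : nat) (x : 'cV[quat R]_N) (k : nat) :
    quat R :=
  if insub k.-1 is Some i then x i 0 else 0.

Definition extend (R : realType) (N : nat) (h1 h2 : quat R)
    (x : 'cV[quat R]_N) (k : nat) : quat R :=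
  if k == 0%N then - (h1 * vcoord x 1)
  else if k == N.+1 then - (h2 * vcoord x N)
  else vcoord x k.

Definition diffexpr (R : realType) (a b x : nat -> quat R) (k : nat) : quat R :=
  b k * x k.+1 + a k * x k + b k.-1 * x k.-1.

(* The index i : 'I_N stands for k = i + 1. *)
Definition Lop (R : realType) (N : nat) (a b : nat -> quat R)
    (h1 h2 : quat R) (x : 'cV[quat R]_N) : 'cV[quat R]_N :=
  \col_(i < N) diffexpr a b (extend h1 h2 x) i.+1.

Lemma Lop_right_linear (R : realType) (N : nat) (a b : nat -> quat R)
    (h1 h2 : quat R) : right_linear (@Lop R N a b h1 h2).
Proof.
have cD x y k : @vcoord R N (x + y) k = vcoord x k + vcoord y k.
  by rewrite /vcoord; case: insubP => [i _ _|_]; rewrite ?mxE ?addr0.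
have cZ x q k : @vcoord R N (vscale x q) k = vcoord x k * q.
  by rewrite /vcoord; case: insubP => [i _ _|_]; rewrite ?mxE ?mul0r.
have eD x y k : @extend R N h1 h2 (x + y) k =
    extend h1 h2 x k + extend h1 h2 y k.
  by rewrite /extend; case: (k == 0%N); case: (k == N.+1);
    rewrite cD // mulrDr opprD.
have eZ x q k : @extend R N h1 h2 (vscale x q) k = extend h1 h2 x k * q.
  by rewrite /extend; case: (k == 0%N); case: (k == N.+1);
    rewrite cZ // mulrA mulNr.
split=> [x y|x q]; apply/matrixP => i j; rewrite !mxE /diffexpr.
  by rewrite !eD !mulrDr (addrACA (b i.+1 * _)) (addrACA (_ + _)).
by rewrite !eZ !mulrA -!mulrDl.
Qed.

(* So the adjoint in [normal_op (Lop a b h1 h2)] always exists, and it is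
   unique by [adjoint_unique]. *)
Lemma Lop_adjoint (R : realType) (N : nat) (a b : nat -> quat R)
    (h1 h2 : quat R) : exists Ls, is_adjoint (@Lop R N a b h1 h2) Ls.
Proof. exact/adjoint_exists/Lop_right_linear. Qed.

Definition solves_E (R : realType) (N : nat) (a b : nat -> quat R)
    (lam : quat R) (x : nat -> quat R) : Prop :=
  forall k, (1 <= k <= N)%N -> diffexpr a b x k = x k * lam.

Definition solves_B1 (R : realType) (h1 : quat R) (x : nat -> quat R) : Prop :=
  x 0%N + h1 * x 1%N = 0.

(* Only the values at k <= N + 1 are meaningful: see [phi_solution] and
   [phi_unique]. *)
Fixpoint phi (R : realType) (a b : nat -> quat R) (h1 : quat R)
    (k : nat) (lam s : quat R) : quat R :=
  match k with
  | 0 => - (h1 * s)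
  | 1 => s
  | (k'.+1 as m).+1 =>
      (b m)^-1 * (phi a b h1 m lam s * lam - a m * phi a b h1 m lam s
                  - b k' * phi a b h1 k' lam s)
  end.

Lemma phiSS (R : realType) (a b : nat -> quat R) (h1 lam s : quat R) k :
  phi a b h1 k.+2 lam s =
  (b k.+1)^-1 * (phi a b h1 k.+1 lam s * lam - a k.+1 * phi a b h1 k.+1 lam s
                 - b k * phi a b h1 k lam s).
Proof. by []. Qed.

Lemma phi_solution (R : realType) (N : nat) (a b : nat -> quat R)
    (h1 lam s : quat R) :
  (forall k, (k <= N)%N -> b k != 0) ->
  [/\ solves_E N a b lam (fun k => phi a b h1 k lam s),
      solves_B1 h1 (fun k => phi a b h1 k lam s)
    & phi a b h1 1 lam s = s].
Proof.
move=> b0; split; [|by rewrite /solves_B1 /= addNr|by []].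
case=> // k /= kN; rewrite /diffexpr /=; case: k kN => [|k] kN;
  by rewrite mulVKr ?quat_unitE ?b0 // addrAC !subrK.
Qed.

Lemma phi_unique (R : realType) (N : nat) (a b : nat -> quat R)
    (h1 lam s : quat R) (x : nat -> quat R) :
  (forall k, (k <= N)%N -> b k != 0) ->
  solves_E N a b lam x -> solves_B1 h1 x -> x 1%N = s ->
  forall k, (k <= N.+1)%N -> x k = phi a b h1 k lam s.
Proof.
move=> b0 xE xB x1.
have H k : (k <= N)%N ->
    x k = phi a b h1 k lam s /\ x k.+1 = phi a b h1 k.+1 lam s.
  elim: k => [_|k IH kN].
    by split=> //=; move/eqP: xB; rewrite addr_eq0 x1 => /eqP.
  have [xk xk1] := IH (ltnW kN); split=> //.
  rewrite phiSS -xk -xk1 -(xE k.+1 kN) /diffexpr /=.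
  by rewrite (addrAC _ (- _)) !addrK mulKr // quat_unitE b0.
case=> [|k] kN; first by have [] := H 0%N isT.
by have [] := H k kN.
Qed.

Definition phivec (R : realType) (N : nat) (a b : nat -> quat R)
    (h1 lam s : quat R) : 'cV[quat R]_N :=
  \col_(i < N) phi a b h1 i.+1 lam s.

Definition pN (R : realType) (N : nat) (a b : nat -> quat R)
    (h1 h2 lam s : quat R) : quat R :=
  phi a b h1 N.+1 lam s + h2 * phi a b h1 N lam s.

Definition is_leftpoly (R : realType) (n : nat)
    (f : quat R -> quat R -> quat R) : Prop :=
  exists c : nat -> quat R, forall lam s,
    f lam s = \sum_(j < n) c j * s * lam ^+ j.

Lemma leftpoly_widen (R : realType) n (f : quat R -> quat R -> quat R) :
  is_leftpoly n f -> is_leftpoly n.+1 f.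
Proof.
move=> [c cE]; exists (fun j => if (j < n)%N then c j else 0) => lam s.
rewrite cE big_ord_recr /= ltnn !mul0r addr0.
by apply: eq_bigr => j _; rewrite ltn_ord.
Qed.
Lemma leftpolyB (R : realType) n (f g : quat R -> quat R -> quat R) :
  is_leftpoly n f -> is_leftpoly n g ->
  is_leftpoly n (fun lam s => f lam s - g lam s).
Proof.
move=> [c cE] [d dE]; exists (fun j => c j - d j) => lam s.
by rewrite cE dE -sumrB; apply: eq_bigr => j _; rewrite !mulrBl.
Qed.
Lemma leftpolyM (R : realType) n (q : quat R) (f : quat R -> quat R -> quat R) :
  is_leftpoly n f -> is_leftpoly n (fun lam s => q * f lam s).
Proof.
move=> [c cE]; exists (fun j => q * c j) => lam s.
by rewrite cE mulr_sumr; apply: eq_bigr => j _; rewrite !mulrA.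
Qed.
Lemma leftpolyX (R : realType) n (f : quat R -> quat R -> quat R) :
  is_leftpoly n f -> is_leftpoly n.+1 (fun lam s => f lam s * lam).
Proof.
move=> [c cE]; exists (fun j => if j is j'.+1 then c j' else 0) => lam s.
rewrite cE big_ord_recl /= !mul0r add0r mulr_suml.
by apply: eq_bigr => j _; rewrite /bump /= add1n exprSr mulrA.
Qed.

Lemma phi_poly (R : realType) (a b : nat -> quat R) (h1 : quat R) (k : nat) :
  is_leftpoly k.+1 (phi a b h1 k.+1).
Proof.
suff [] : is_leftpoly k.+1 (phi a b h1 k) /\ is_leftpoly k.+1 (phi a b h1 k.+1).
  by [].
elim: k => [|k [IH0 IH1]].
  split; [exists (fun=> - h1)|exists (fun=> 1)] => lam s;
  by rewrite big_ord1 expr0 mulr1 ?mul1r ?mulNr.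
split; first exact: leftpoly_widen.
apply: leftpolyM; apply: leftpolyB; last first.
  exact/leftpolyM/leftpoly_widen.
by apply: leftpolyB; [exact: leftpolyX|exact/leftpolyM/leftpoly_widen].
Qed.

Definition theta (R : realType) (q : quat R) : set (quat R) :=
  [set al^-1 * q * al | al in [set al : quat R | al != 0]]%classic.

(* The coefficients of p_N stand to the left of the powers of lambda, so its
   zeros are those of the function below, by [phi_poly]. *)
Definition spherical_zero (R : realType) (p : quat R -> quat R) (z0 : quat R) :
    Prop :=
  ~ range (@quat_of_real R) z0 /\ (forall z, theta z0 z -> p z = 0).

Definition f_s (R : realType) (N : nat) (a b : nat -> quat R) (h1 : quat R)
    (F : 'I_N -> quat R) (s lam : quat R) : quat R :=
  \sum_(i < N) qconj (F i) * phi a b h1 i.+1 lam s.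

Definition sampling_expansion (R : realType) (N : nat) (a b : nat -> quat R)
    (h1 s : quat R) (f : quat R -> quat R) (lams : 'I_N -> quat R) : Prop :=
  forall lam,
    f lam = \sum_(k < N) f (lams k) *
      (inner (phivec N a b h1 (lams k) s) (phivec N a b h1 lam s)
       / quat_of_real (vnorm (phivec N a b h1 (lams k) s) ^+ 2)).

(* Two expansions count as the same when their sets of sample points agree. *)
Definition sample_sets (R : realType) (N : nat) (a b : nat -> quat R)
    (h1 s : quat R) (f : quat R -> quat R) : set (set (quat R)) :=
  [set range lams | lams in
    [set lams : 'I_N -> quat R | sampling_expansion a b h1 s f lams]]%classic.

(* Main.v *)
(* An eigenvector x of L has x(1) <> 0, and scaled to x(1) = s it is some
   phi(., mu, s). So any orthogonal eigenbasis gives an orthogonal basis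
   phi(., lambda_k, s), and expanding phi(., lambda, s) in it is a sampling
   expansion with sample points lambda_k. On the orbit of a spherical zero every
   point z gives an eigenvector phi(., z, s). Since L is normal, the orthogonal
   complement of eigenvectors is L-invariant; by factoring over the complex
   numbers a polynomial that kills a vector of it, one finds a further
   eigenvector there, so phi(., z, s) extends to an orthogonal eigenbasis. Hence
   every point of this infinite orbit occurs in a set of sample points, while
   each such set is finite. *)
Require Import Defs.
From mathcomp Require Import all_boot all_order all_algebra.
From mathcomp Require Import boolp classical_sets cardinality reals.
From mathcomp Require Import ring lra.
From mathcomp.real_closed Require Import complex.
Import Order.TTheory GRing.Theory Num.Theory.
Local Open Scope ring_scope.

(** * Quaternion arithmetic *)

Lemma quat_of_real_comm {R : realType} (r : R) (q : quat R) :
  GRing.comm (quat_of_real r) q.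
Proof. by apply: quatP => /=; ring. Qed.

Lemma quat_of_realD {R : realType} (r t : R) :
  quat_of_real (r + t) = quat_of_real r + quat_of_real t.
Proof. by apply: quatP => /=; rewrite ?addr0. Qed.

Lemma quat_of_real_eq0 {R : realType} (r : R) :
  (quat_of_real r == 0) = (r == 0).
Proof. by apply/eqP/eqP => [[]|->]. Qed.

Lemma qconjK {R : realType} : involutive (@qconj R).
Proof. by move=> q; apply: quatP => /=; rewrite ?opprK. Qed.

Lemma qmul_conj {R : realType} (q : quat R) :
  q * qconj q = quat_of_real (qnorm2 q).
Proof. by apply: quatP; rewrite /= /qnorm2; ring. Qed.

Lemma qconj_mul {R : realType} (q : quat R) :
  qconj q * q = quat_of_real (qnorm2 q).
Proof. by apply: quatP; rewrite /= /qnorm2; ring. Qed.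

Lemma qnorm2_ge0 {R : realType} (q : quat R) : 0 <= qnorm2 q.
Proof. by rewrite /qnorm2 !addr_ge0 ?sqr_ge0. Qed.

Lemma quat_mulf_neq0 {R : realType} (p q : quat R) :
  p != 0 -> q != 0 -> p * q != 0.
Proof.
move=> p0; apply: contraNneq => pq0.
by rewrite -(mulKr (p0 : p \is a GRing.unit) q) pq0 mulr0.
Qed.

(** * The quaternionic inner product *)

Lemma vscaleE {R : realType} {N : nat} (x : 'cV[quat R]_N) (q : quat R) :
  vscale x q = x *m q%:M.
Proof.
by apply/matrixP => i j; rewrite !mxE big_ord1 !mxE (ord1 j) eqxx.
Qed.

Lemma vscale_suml {R : realType} {N n : nat} (x : 'I_n -> 'cV[quat R]_N)
    (q : quat R) :
  vscale (\sum_k x k) q = \sum_k vscale (x k) q.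
Proof.
by rewrite vscaleE mulmx_suml; apply: eq_bigr => k _; rewrite vscaleE.
Qed.

Lemma vscaleA {R : realType} {N : nat} (x : 'cV[quat R]_N) (p q : quat R) :
  vscale (vscale x p) q = vscale x (p * q).
Proof. by rewrite !vscaleE -mulmxA -scalar_mxM. Qed.

Lemma vscale_eq0 {R : realType} {N : nat} (x : 'cV[quat R]_N) (q : quat R) :
  q != 0 -> (vscale x q == 0) = (x == 0).
Proof.
move=> q0; apply/eqP/eqP => [xq0|->]; last by rewrite vscaleE mul0mx.
have := vscaleA x q q^-1; rewrite xq0 mulrV // !vscaleE mul0mx.
by rewrite mulmx1 => <-.
Qed.

Lemma qconj_inner {R : realType} {N : nat} (x y : 'cV[quat R]_N) :
  qconj (inner x y) = inner y x.
Proof.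
rewrite /inner; elim/big_rec2: _ => [|i p q _ <-]; first exact: qconj0.
by rewrite qconjD qconjM qconjK.
Qed.

Lemma innerDr {R : realType} {N : nat} (x y z : 'cV[quat R]_N) :
  inner x (y + z) = inner x y + inner x z.
Proof. by rewrite -qconj_inner innerDl qconjD !qconj_inner. Qed.

Lemma inner0r {R : realType} {N : nat} (x : 'cV[quat R]_N) : inner x 0 = 0.
Proof. by rewrite -qconj_inner inner0l qconj0. Qed.

Lemma innerBr {R : realType} {N : nat} (x y z : 'cV[quat R]_N) :
  inner x (y - z) = inner x y - inner x z.
Proof. by apply/eqP; rewrite eq_sym subr_eq -innerDr subrK. Qed.

Lemma innerBl {R : realType} {N : nat} (x y z : 'cV[quat R]_N) :
  inner (x - y) z = inner x z - inner y z.
Proof. by apply/eqP; rewrite eq_sym subr_eq -innerDl subrK. Qed.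

Lemma inner_sumr {R : realType} {N n : nat} (x : 'cV[quat R]_N)
    (y : 'I_n -> 'cV[quat R]_N) :
  inner x (\sum_k y k) = \sum_k inner x (y k).
Proof.
by elim/big_rec2: _ => [|k u v _ <-]; [exact: inner0r | exact: innerDr].
Qed.

Lemma inner_vscaler {R : realType} {N : nat} (x y : 'cV[quat R]_N)
    (q : quat R) : inner x (vscale y q) = inner x y * q.
Proof. by rewrite -qconj_inner inner_vscalel qconjM qconjK qconj_inner. Qed.

Definition sqnorm {R : realType} {N : nat} (x : 'cV[quat R]_N) : R :=
  \sum_(i < N) qnorm2 (x i 0).

Lemma inner_sqnorm {R : realType} {N : nat} (x : 'cV[quat R]_N) :
  inner x x = quat_of_real (sqnorm x).
Proof. exact: innerxx. Qed.

Lemma sqnorm_ge0 {R : realType} {N : nat} (x : 'cV[quat R]_N) : 0 <= sqnorm x.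
Proof. by apply: sumr_ge0 => i _; exact: qnorm2_ge0. Qed.

Lemma vnorm_sqr {R : realType} {N : nat} (x : 'cV[quat R]_N) :
  vnorm x ^+ 2 = sqnorm x.
Proof. by rewrite /vnorm inner_sqnorm sqr_sqrtr ?sqnorm_ge0. Qed.

Lemma sqnorm_eq0 {R : realType} {N : nat} (x : 'cV[quat R]_N) :
  (sqnorm x == 0) = (x == 0).
Proof.
apply/eqP/eqP => [x0|->]; last first.
  by rewrite /sqnorm big1 // => i _; rewrite mxE /qnorm2 /= expr0n !addr0.
apply/matrixP => i j; rewrite (ord1 j) mxE; apply/eqP.
have /psumr_eq0P : forall i : 'I_N, true -> 0 <= qnorm2 (x i 0).
  by move=> k _; exact: qnorm2_ge0.
move=> /(_ x0 i isT) xi; apply/negPn/negP => /qnorm2_neq0.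
by rewrite xi eqxx.
Qed.

(** For [y] the difference of the two sides, [inner y y] reduces to
    [inner (Ts x) y = inner x (T y)], which vanishes by normality. *)
Lemma normal_eigen_adjoint {R : realType} {N : nat}
    (T Ts : 'cV[quat R]_N -> 'cV[quat R]_N) (x : 'cV[quat R]_N) (z : quat R) :
  right_linear T -> is_adjoint T Ts -> T \o Ts =1 Ts \o T ->
  T x = vscale x z -> Ts x = vscale x (qconj z).
Proof.
move=> [TD TZ] adj comm Txz; apply/eqP; rewrite -subr_eq0 -sqnorm_eq0.
have xTs y : inner x (Ts y) = qconj z * inner x y.
  by rewrite -adj Txz inner_vscalel.
have TB u v : T (u - v) = T u - T v.
  by apply/eqP; rewrite eq_sym subr_eq -TD subrK.
rewrite -quat_of_real_eq0 -inner_sqnorm.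
set y := Ts x - _; apply/eqP.
have xy0 : inner x y = 0.
  by rewrite innerBr xTs inner_vscaler inner_sqnorm quat_of_real_comm subrr.
(* Once [T] and [Ts] are swapped, both terms equal |x|^2 |z|^2, because z commutes with its
   conjugate. *)
have Ty0 : inner x (T y) = 0.
  have := comm x; rewrite /= => TTs.
  rewrite TB TTs TZ Txz innerBr xTs !inner_vscaler inner_sqnorm.
  by rewrite -mulrA !mulrA -quat_of_real_comm -!mulrA qmul_conj qconj_mul subrr.
rewrite {1}/y innerBl inner_vscalel qconjK xy0 mulr0 subr0.
by rewrite -qconj_inner -adj qconj_inner Ty0.
Qed.

(** By normality [x] is an eigenvector of the adjoint too, so moving [T] across leaves a multiple of
    [inner x y]. *)
Lemma eigen_orthogonal_stable {R : realType} {N : nat}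
    (T : 'cV[quat R]_N -> 'cV[quat R]_N) (x y : 'cV[quat R]_N) (z : quat R) :
  right_linear T -> normal_op T -> T x = vscale x z ->
  inner x y = 0 -> inner x (T y) = 0.
Proof.
move=> Tlin [Ts adj comm] Txz xy0.
have Tsx := normal_eigen_adjoint T Ts x z Tlin adj comm Txz.
by rewrite -qconj_inner adj Tsx qconj_inner inner_vscalel qconjK xy0 mulr0.
Qed.

(** * Completing orthogonal families *)

Definition orthogonal_proj {R : realType} {N : nat} (m : nat)
    (u : nat -> 'cV[quat R]_N) (x : 'cV[quat R]_N) : 'cV[quat R]_N :=
  \sum_(k < m) vscale (u k) (inner (u k) x / quat_of_real (sqnorm (u k))).

Definition orthogonal_family {R : realType} {N : nat} (m : nat)
    (u : nat -> 'cV[quat R]_N) : Prop :=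
  (forall k, (k < m)%N -> u k != 0) /\
  (forall k l, (k < m)%N -> (l < m)%N -> k != l -> inner (u k) (u l) = 0).

Lemma inner_proj_resid {R : realType} {N m : nat} (u : nat -> 'cV[quat R]_N)
    (x : 'cV[quat R]_N) (k : nat) :
  orthogonal_family m u -> (k < m)%N ->
  inner (u k) (x - orthogonal_proj m u x) = 0.
Proof.
move=> [u0 uo] km; rewrite innerBr inner_sumr (bigD1 (Ordinal km)) //=.
rewrite big1 ?addr0 => [|l /= lk]; last first.
  rewrite inner_vscaler uo ?mul0r //.
  by apply: contraNneq lk => kl; apply/eqP/val_inj.
rewrite inner_vscaler inner_sqnorm quat_of_real_comm divrK ?subrr //.
by rewrite quat_unitE quat_of_real_eq0 sqnorm_eq0 u0.
Qed.

Lemma proj_resid_orthogonal {R : realType} {N m : nat}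
    (u : nat -> 'cV[quat R]_N) (x y : 'cV[quat R]_N) :
  (forall k, (k < m)%N -> inner (u k) x = 0) ->
  inner (orthogonal_proj m u y) x = 0.
Proof.
move=> ux; rewrite -qconj_inner inner_sumr big1 ?qconj0 // => k _.
by rewrite inner_vscaler -qconj_inner ux // qconj0 mul0r.
Qed.

(* For an orthonormal family this is the trace of the projection onto the
   orthogonal complement; it replaces dimension theory over the quaternions. *)
Lemma sum_sqnorm_resid {R : realType} {N m : nat} (u : nat -> 'cV[quat R]_N) :
  orthogonal_family m u ->
  \sum_(i < N) sqnorm (delta_mx i 0 - orthogonal_proj m u (delta_mx i 0))
    = N%:R - m%:R.
Proof.
move=> uo.
have entry i : sqnorm (delta_mx i 0 - orthogonal_proj m u (delta_mx i 0)) =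
    1 - \sum_(k < m) qnorm2 (u k i 0) / sqnorm (u k).
  set e := delta_mx i 0; set r := e - _.
  (* The residual is orthogonal to the projection of [e], so [inner r r = inner e r]. *)
  have rr : inner r r = r i 0.
    rewrite {1}/r innerBl proj_resid_orthogonal ?subr0 ?inner_delta // => k km.
    exact: inner_proj_resid.
  have -> : sqnorm r = qre (r i 0) by rewrite -rr inner_sqnorm.
  rewrite !mxE !eqxx summxE /=; congr (1 - _).
  elim/big_rec2: _ => [|k p q _ <-] //=; congr (_ + _).
  rewrite mxE -[inner _ e]qconj_inner inner_delta mulrA qmul_conj.
  have : sqnorm (u k) != 0 by rewrite sqnorm_eq0; case: uo => + _; apply.
  by rewrite /= /qnorm2 /= => uk0; field.
under eq_bigr do rewrite entry.
rewrite sumrB sumr_const card_ord exchange_big /=; congr (_ - _).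
under eq_bigr => k _.
  rewrite -mulr_suml divff; last first.
    by rewrite sqnorm_eq0; case: uo => + _; apply.
  over.
by rewrite sumr_const card_ord.
Qed.

(** Otherwise every residual vanishes, and then so does their trace [N - m]. *)
Lemma orthogonal_extension {R : realType} {N m : nat}
    (u : nat -> 'cV[quat R]_N) :
  orthogonal_family m u -> (m < N)%N ->
  exists2 x, x != 0 & forall k, (k < m)%N -> inner (u k) x = 0.
Proof.
move=> uo mN; apply: contrapT => none.
have resid0 x : x - orthogonal_proj m u x = 0.
  apply/eqP/negPn/negP => r0; apply: none; eexists; first exact: r0.
  by move=> k; exact: inner_proj_resid.
have := sum_sqnorm_resid u uo; rewrite big1 => [/eqP|i _]; last first.
  by apply/eqP; rewrite resid0 sqnorm_eq0.
by rewrite eq_sym subr_eq0 eqr_nat => /eqP NM; rewrite NM ltnn in mN.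
Qed.

(** For [m = N] the trace is 0, so each standard basis vector equals its projection. A residual is
    orthogonal to all projections, hence has zero coordinates. *)
Lemma orthogonal_basis_expansion {R : realType} {N : nat}
    (u : nat -> 'cV[quat R]_N) (x : 'cV[quat R]_N) :
  orthogonal_family N u -> orthogonal_proj N u x = x.
Proof.
move=> uo; set r := x - orthogonal_proj N u x.
have e0 (i : 'I_N) :
    delta_mx i 0 = orthogonal_proj N u (delta_mx i 0) :> 'cV[quat R]_N.
  apply/eqP; rewrite -subr_eq0 -sqnorm_eq0.
  have := sum_sqnorm_resid u uo; rewrite subrr => /psumr_eq0P -> //.
  by move=> j _; exact: sqnorm_ge0.
apply/esym/eqP; rewrite -subr_eq0 -/r; apply/eqP/matrixP => i j.
rewrite (ord1 j) -[LHS]inner_delta e0 proj_resid_orthogonal ?mxE // => k kN.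
exact: inner_proj_resid.
Qed.

(** * Eigenvectors in invariant submodules *)

Definition quat_of_complex {R : realType} (c : R[i]) : quat R :=
  Quat (complex.Re c) (complex.Im c) 0 0.

Lemma quat_of_complexB {R : realType} (c d : R[i]) :
  quat_of_complex (c - d) = quat_of_complex c - quat_of_complex d.
Proof. by case: c d => ? ? [? ?]; apply: quatP; rewrite /= ?subr0. Qed.

Lemma quat_of_complexM {R : realType} (c d : R[i]) :
  quat_of_complex (c * d) = quat_of_complex c * quat_of_complex d.
Proof. by case: c d => ? ? [? ?]; apply: quatP => /=; ring. Qed.

Lemma quat_of_complex_eq0 {R : realType} (c : R[i]) :
  (quat_of_complex c == 0) = (c == 0).
Proof. by case: c => x y; apply/eqP/eqP => [[-> ->]|[-> ->]]. Qed.

Lemma right_linear_sum {R : realType} {N n : nat}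
    (T : 'cV[quat R]_N -> 'cV[quat R]_N) (x : 'I_n -> 'cV[quat R]_N) :
  right_linear T -> T (\sum_k x k) = \sum_k T (x k).
Proof.
move=> [TD _]; have T0 : T 0 = 0 by apply: (addrI (T 0)); rewrite -TD !addr0.
by elim/big_rec2: _ => [//|k u v _ <-]; exact: TD.
Qed.

(* Right multiplication by the copy of R[i] in the quaternions makes the
   vectors a module over the polynomials with complex coefficients, on which
   the variable acts as T. *)
Definition poly_act {R : realType} {N : nat}
    (T : 'cV[quat R]_N -> 'cV[quat R]_N) (n : nat) (p : {poly R[i]})
    (x : 'cV[quat R]_N) : 'cV[quat R]_N :=
  \sum_(k < n) vscale (iter k T x) (quat_of_complex p`_k).

(** Multiplying by ['X] shifts the coefficients, which matches one more application of [T], as right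
    linearity lets [T] pass the scalars. The constant [c] can be moved to the right because complex
    coefficients commute. *)
Lemma poly_act_XsubC {R : realType} {N : nat}
    (T : 'cV[quat R]_N -> 'cV[quat R]_N) (n : nat) (c : R[i])
    (p : {poly R[i]}) (x : 'cV[quat R]_N) :
  right_linear T -> (size p <= n)%N ->
  poly_act T n.+1 (('X - c%:P) * p) x =
  T (poly_act T n p x) - vscale (poly_act T n p x) (quat_of_complex c).
Proof.
move=> Tlin pn; have [_ TZ] := Tlin.
have vB (y : 'cV[quat R]_N) (q r : quat R) :
    vscale y (q - r) = vscale y q - vscale y r.
  by apply/matrixP => i j; rewrite !mxE mulrBr.
have v0 (y : 'cV[quat R]_N) : vscale y (quat_of_complex 0) = 0.
  by rewrite vscaleE (_ : quat_of_complex 0 = 0) ?raddf0 ?mulmx0.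
rewrite /poly_act (right_linear_sum _ _ Tlin) vscale_suml.
under eq_bigr => k _.
  rewrite mulrBl coefB coefXM coefCM quat_of_complexB vB; over.
rewrite sumrB; congr (_ - _).
  rewrite big_ord_recl /= v0 add0r; apply: eq_bigr => k _.
  by rewrite TZ.
(* The extra top term has index [n], where [p] has no coefficient. *)
rewrite big_ord_recr /= nth_default // mulr0 v0 addr0.
by apply: eq_bigr => k _; rewrite vscaleA mulrC quat_of_complexM.
Qed.

(* The T^k x lie in a space of real dimension 4 N. *)
Lemma krylov_dependence {R : realType} {N : nat}
    (T : 'cV[quat R]_N -> 'cV[quat R]_N) (x : 'cV[quat R]_N) :
  exists2 p : {poly R[i]}, p != 0 &
    forall n, (size p <= n)%N -> poly_act T n p x = 0.
Proof.
(* One more vector than the real dimension, so the rows of [A] below are dependent. *)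
set n := (N + N + (N + N)).+1.
pose M (c : quat R -> R) : 'M[R]_(n, N) := \matrix_(k, i) c (iter k T x i 0).
pose A := row_mx (row_mx (M (@qre R)) (M (@qi R)))
                 (row_mx (M (@qj R)) (M (@qk R))).
have /rowV0Pn [v vA v0] : kermx A != 0.
  by rewrite -mxrank_eq0 mxrank_ker -lt0n subn_gt0 ltnS rank_leq_col.
move: vA; rewrite sub_kermx /A !mul_mx_row => /eqP.
rewrite -(row_mx0 _ 1 (N + N) (N + N)) -(row_mx0 _ 1 N N).
move=> /eq_row_mx [/eq_row_mx [vre vi] /eq_row_mx [vj vk]].
pose p : {poly R[i]} := \poly_(k < n) Complex (v 0 (inord k)) 0.
have pE k : (k < n)%N -> p`_k = Complex (v 0 (inord k)) 0.
  by move=> kn; rewrite coef_poly kn.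
have act0 : poly_act T n p x = 0.
  rewrite /poly_act; apply/matrixP => i j; rewrite (ord1 j) summxE mxE.
  have coord (f : quat R -> R) :
      f 0 = 0 -> {morph f : q r / q + r} ->
      (forall q r, f (q * quat_of_real r) = f q * r) -> v *m M f = 0 ->
      f (\sum_(k < n) vscale (iter k T x) (quat_of_complex p`_k) i 0) = 0.
    move=> f0 fD fZ /matrixP /(_ 0 i); rewrite !mxE => vM.
    rewrite (big_morph f fD f0) -[RHS]vM; apply: eq_bigr => k _.
    by rewrite pE // inord_val !mxE fZ mulrC.
  by apply: quatP => /=; apply: coord => // [[? ? ? ?] ?] /=; ring.
exists p => [|m pm].
  apply: contraNneq v0 => p0; apply/eqP/rowP => k; rewrite mxE.
  by have := pE k (ltn_ord k); rewrite p0 coef0 inord_val => -[].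
rewrite -[RHS]act0 /poly_act.
have v00 (y : 'cV[quat R]_N) : vscale y (quat_of_complex 0) = 0.
  by rewrite vscaleE (_ : quat_of_complex 0 = 0) ?raddf0 ?mulmx0.
(* Coefficients beyond [size p] are 0, so any sufficient truncation length gives the same action. *)
have widen (l : nat) : (size p <= l)%N ->
    poly_act T l p x = poly_act T (size p) p x.
  move=> pl; rewrite /poly_act [RHS](big_ord_widen l (fun k =>
    vscale (iter k T x) (quat_of_complex p`_k))) // [RHS]big_mkcond.
  apply: eq_bigr => k _; case: ltnP => // pk.
  by rewrite nth_default // v00.
by rewrite -/(poly_act T m p x) -/(poly_act T n p x) !widen ?size_poly.
Qed.

(** A polynomial annihilating [x] splits into linear factors. Applying these one at a time to [x],
    the last nonzero vector is an eigenvector, and it stays in [W]. *)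
Lemma invariant_eigenvector {R : realType} {N : nat}
    (T : 'cV[quat R]_N -> 'cV[quat R]_N) (W : 'cV[quat R]_N -> Prop)
    (x : 'cV[quat R]_N) :
  right_linear T ->
  (forall y z, W y -> W z -> W (y + z)) ->
  (forall y q, W y -> W (vscale y q)) ->
  (forall y, W y -> W (T y)) ->
  x != 0 -> W x ->
  exists y lam, [/\ W y, y != 0 & T y = vscale y lam].
Proof.
move=> Tlin WD WZ WT x0 Wx.
have [p p0 px0] := krylov_dependence T x.
have [rs pE] := closed_field_poly_normal p.
have qx0 : poly_act T (size rs).+1 (\prod_(z <- rs) ('X - z%:P)) x = 0.
  have lc0 : quat_of_complex (lead_coef p) != 0.
    by rewrite quat_of_complex_eq0 lead_coef_eq0.
  apply/eqP; rewrite -(vscale_eq0 _ _ lc0) -(px0 (size rs).+1); last first.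
    by rewrite pE (leq_trans (size_scale_leq _ _)) // size_prod_XsubC.
  rewrite /poly_act vscale_suml; apply/eqP/eq_bigr => k _.
  by rewrite vscaleA {2}pE coefZ -quat_of_complexM mulrC.
have Wact (r : {poly R[i]}) m : W (poly_act T m r x).
  apply: (big_ind W) => //.
    by have := WZ x 0 Wx; rewrite vscaleE raddf0 mulmx0.
  move=> k _; apply: WZ; elim: (nat_of_ord k) => //= l; exact: WT.
elim: rs {pE} qx0 => [|c rs IH].
  rewrite big_nil /poly_act big_ord1 coef1 /= vscaleE mulmx1 => x00.
  by rewrite x00 eqxx in x0.
rewrite big_cons poly_act_XsubC ?size_prod_XsubC // => /eqP.
rewrite subr_eq0 => /eqP Ty.
set y := poly_act _ _ _ _ in Ty *; have [/IH //|y0] := eqVneq y 0.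
by exists y, (quat_of_complex c); split=> //; exact: Wact.
Qed.

(** * Eigenvectors of the difference operator *)

Lemma vcoord_ord {R : realType} {N : nat} (x : 'cV[quat R]_N) (i : 'I_N) :
  vcoord x i.+1 = x i 0.
Proof. by rewrite /vcoord /= valK. Qed.

Lemma vcoordE {R : realType} {N k : nat} (x : 'cV[quat R]_N) (kN : (k < N)%N) :
  vcoord x k.+1 = x (Ordinal kN) 0.
Proof. exact: (vcoord_ord x (Ordinal kN)). Qed.

Lemma extend_vscale {R : realType} {N : nat} (h1 h2 : quat R)
    (x : 'cV[quat R]_N) (q : quat R) (k : nat) :
  extend h1 h2 (vscale x q) k = extend h1 h2 x k * q.
Proof.
have cZ l : vcoord (vscale x q) l = vcoord x l * q.
  by rewrite /vcoord; case: insubP => [i _ _|_]; rewrite ?mxE ?mul0r.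
by rewrite /extend !cZ; case: ifP => _; [|case: ifP => _ //];
  rewrite mulrA mulNr.
Qed.

Lemma extend_ord {R : realType} {N : nat} (h1 h2 : quat R)
    (x : 'cV[quat R]_N) (i : 'I_N) : extend h1 h2 x i.+1 = x i 0.
Proof. by rewrite /extend /= eqSS ltn_eqF // vcoord_ord. Qed.

Section DifferenceOperator.

Context {R : realType} {N : nat} (a b : nat -> quat R) (h1 h2 s : quat R).
Hypothesis N_gt0 : (0 < N)%N.
Hypothesis b_neq0 : forall k, (k <= N)%N -> b k != 0.
Hypothesis s_neq0 : s != 0.

Let L := @Lop R N a b h1 h2.
Let Phi (lam : quat R) := phivec N a b h1 lam s.

Lemma phivec_neq0 (lam : quat R) : Phi lam != 0.
Proof.
apply: contraNneq s_neq0 => /matrixP /(_ (Ordinal N_gt0) 0).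
by rewrite !mxE /= => ->.
Qed.

(** A zero of p_N is where the solution also satisfies (B_2), so the boundary value at N + 1 agrees
    with the recursion. *)
Lemma extend_phivec (lam : quat R) (k : nat) :
  pN N a b h1 h2 lam s = 0 -> (k <= N.+1)%N ->
  extend h1 h2 (Phi lam) k = phi a b h1 k lam s.
Proof.
move=> root; case: k => [_|k].
  by rewrite /extend /= (vcoordE _ N_gt0) mxE.
rewrite ltnS leq_eqVlt => /orP [/eqP ->|kN]; last first.
  by rewrite (extend_ord _ _ _ (Ordinal kN)) mxE.
have predN : (N.-1 < N)%N by rewrite prednK.
have := vcoordE (Phi lam) predN; rewrite mxE prednK // => vN.
rewrite /extend eqxx vN.
by apply/esym/eqP; rewrite -addr_eq0; apply/eqP; exact: root.
Qed.

Lemma root_eigenvector (lam : quat R) :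
  pN N a b h1 h2 lam s = 0 -> L (Phi lam) = vscale (Phi lam) lam.
Proof.
move=> root; apply/matrixP => i j; rewrite (ord1 j) !mxE.
have [phiE _ _] := @phi_solution R N a b h1 lam s b_neq0.
rewrite -(phiE i.+1 (ltn_ord i)) /diffexpr /=.
have iN := ltn_ord i; have iN1 := leqW iN.
by rewrite !extend_phivec // ltnW.
Qed.

(** The extended eigenvector solves (E) and (B_1), so x(1) determines it. Hence x(1) is nonzero and
    can be scaled to [s]. *)
Lemma eigenvector_phivec (x : 'cV[quat R]_N) (lam : quat R) :
  x != 0 -> L x = vscale x lam ->
  exists mu q, q != 0 /\ vscale x q = Phi mu.
Proof.
move=> x0 Lx.
have solves y mu : L y = vscale y mu ->
    forall k, (k <= N.+1)%N ->
      extend h1 h2 y k = phi a b h1 k mu (extend h1 h2 y 1).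
  move=> Ly; apply: phi_unique => // [[//|k] /= kN|].
    have /matrixP /(_ (Ordinal kN) 0) := Ly; rewrite !mxE => ->.
    by rewrite (extend_ord _ _ _ (Ordinal kN)).
  rewrite /solves_B1 (extend_ord _ _ _ (Ordinal N_gt0)) /extend /=.
  by rewrite (vcoordE _ N_gt0) addNr.
have phi0 mu k : phi a b h1 k mu 0 = 0.
  suff [] : phi a b h1 k mu 0 = 0 /\ phi a b h1 k.+1 mu 0 = 0 by [].
  elim: k => [|k [IH0 IH1]]; first by rewrite /= mulr0 oppr0.
  by split=> //; rewrite phiSS IH0 IH1 !(mulr0, mul0r, subr0).
have x1 : extend h1 h2 x 1 != 0.
  apply: contraNneq x0 => x1; apply/eqP/matrixP => i j.
  rewrite (ord1 j) -(extend_ord h1 h2) (solves x lam Lx) ?x1 ?phi0 ?mxE //.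
  by rewrite ltnS ltnW.
pose q := (extend h1 h2 x 1)^-1 * s.
have q0 : q != 0 by rewrite quat_mulf_neq0 // -quat_unitE unitrV.
exists (q^-1 * lam * q), q; split=> //.
(* Scaling on the right conjugates the eigenvalue. *)
have Ly : L (vscale x q) = vscale (vscale x q) (q^-1 * lam * q).
  have [_ LZ] := @Lop_right_linear R N a b h1 h2.
  by rewrite /L LZ -/L Lx !vscaleA !mulrA divrr // mul1r.
apply/matrixP => i j; rewrite (ord1 j) -(extend_ord h1 h2) mxE.
rewrite (solves _ _ Ly) ?ltnS 1?ltnW //.
by rewrite extend_vscale mulVKr.
Qed.

(** Induction from the single vector [Phi z]. While the family has fewer than [N] members, its
    orthogonal complement is nonzero and, by normality, invariant, so it contains an eigenvector,
    which is rescaled to some [Phi mu]. *)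
Lemma eigenfamily_extension (z : quat R) (m : nat) :
  normal_op L -> pN N a b h1 h2 z s = 0 -> (0 < m <= N)%N ->
  exists lams : nat -> quat R,
    [/\ lams 0%N = z,
        orthogonal_family m (fun k => Phi (lams k)) &
        forall k, (k < m)%N ->
          exists mu, L (Phi (lams k)) = vscale (Phi (lams k)) mu].
Proof.
move=> Lnormal root; elim: m => // -[_ _|m IH /= mN].
  exists (fun=> z); split=> //.
    by split=> [k _|[|k] [|l]] //; exact: phivec_neq0.
  by move=> k _; exists z; exact: root_eigenvector.
have [lams [lams0 uo eig]] := IH (ltnW mN).
have Llin : right_linear L by exact: Lop_right_linear.
have [x x0 ux] := orthogonal_extension _ uo mN.
pose W y := forall k, (k < m.+1)%N -> inner (Phi (lams k)) y = 0.
have [y [lam [Wy y0 Ly]]] : exists y lam, [/\ W y, y != 0 & L y = vscale y lam].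
  apply: (invariant_eigenvector _ _ x) => //.
  - by move=> y w Wy Ww k km; rewrite innerDr Wy // Ww // addr0.
  - by move=> y q Wy k km; rewrite inner_vscaler Wy // mul0r.
  - move=> y Wy k km; have [mu Lk] := eig k km.
    by apply: (eigen_orthogonal_stable _ _ _ mu) => //; exact: Wy.
have [mu [q [q0 yq]]] := eigenvector_phivec y lam y0 Ly.
have Wq k : (k < m.+1)%N -> inner (Phi (lams k)) (Phi mu) = 0.
  by move=> km; rewrite -yq inner_vscaler Wy // mul0r.
have below k : (k < m.+2)%N -> k != m.+1 -> (k < m.+1)%N.
  by rewrite (ltnS k m.+1) leq_eqVlt => /orP [->|].
exists (fun k => if k == m.+1 then mu else lams k); split=> //.
  split=> [k _|k l]; first exact: phivec_neq0.
  have [->|km] := eqVneq k m.+1; have [->|lm] := eqVneq l m.+1 => km' lm' kl.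
  - by [].
  - by rewrite -qconj_inner Wq ?qconj0 // below.
  - by rewrite Wq // below.
  - by case: uo => _; apply=> //; exact: below.
move=> k; have [-> _|km km'] := eqVneq k m.+1.
  exists (q^-1 * lam * q); rewrite -yq; have [_ LZ] := Llin.
  by rewrite LZ Ly !vscaleA !mulrA divrr // mul1r.
by apply: eig; exact: below.
Qed.

(** Since f_s is the inner product of F with [Phi], expanding [Phi lam] in the orthogonal basis
    gives the sampling formula term by term. *)
Lemma sampling_of_orthogonal (F : 'I_N -> quat R) (lams : nat -> quat R) :
  orthogonal_family N (fun k => Phi (lams k)) ->
  sampling_expansion a b h1 s (f_s a b h1 F s) (fun k : 'I_N => lams k).
Proof.
move=> uo lam.
have fE mu : f_s a b h1 F s mu = inner (\col_i F i) (Phi mu).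
  by apply: eq_bigr => i _; rewrite !mxE.
rewrite fE -[in LHS](orthogonal_basis_expansion _ (Phi lam) uo) inner_sumr.
by apply: eq_bigr => k _; rewrite inner_vscaler fE vnorm_sqr.
Qed.

End DifferenceOperator.

(* Conjugates by n + u, where u is i or j and does not commute with z. *)
Lemma theta_nat_inj {R : realType} (z : quat R) :
  ~ range (@quat_of_real R) z ->
  exists2 f : nat -> quat R, injective f & forall n, theta z (f n).
Proof.
move=> znr; pose qI : quat R := Quat 0 1 0 0; pose qJ : quat R := Quat 0 0 1 0.
(* A quaternion commuting with both i and j is real. *)
have [u [u0 uz]] : exists u : quat R,
    (forall t, quat_of_real t + u != 0) /\ ~ GRing.comm z u.
  apply: contrapT => none.
  have [zI zJ] : GRing.comm z qI /\ GRing.comm z qJ.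
    split; apply: contrapT => zu; apply: none; eexists; split; try exact: zu.
      by move=> t; apply/eqP => -[_ /eqP]; rewrite /= add0r oner_eq0.
    by move=> t; apply/eqP => -[_ _ /eqP]; rewrite /= add0r oner_eq0.
  apply: znr; exists (qre z) => //.
  case: z none zI zJ => w x y k _ [_ _ zk zy] [_ zk' _ zx] /=.
  apply: quatP => /=; lra.
pose p n := quat_of_real n%:R + u.
exists (fun n => (p n)^-1 * z * p n) => [m n /= emn|n]; last first.
  by exists (p n) => //; exact: u0.
apply/eqP; apply: contra_notT uz => mn.
pose d : quat R := quat_of_real (m%:R - n%:R).
have d0 : d != 0 by rewrite quat_of_real_eq0 subr_eq0 eqr_nat.
have dz q : GRing.comm q d by apply/commr_sym/quat_of_real_comm.
have pmn : p m = d + p n by rewrite /p addrA -quat_of_realD subrK.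
have pU k : p k \is a GRing.unit by exact: u0.
have zpm : z * p m = p m * ((p n)^-1 * z * p n).
  by rewrite -emn !mulrA mulrV // mul1r.
(* Equal conjugates make [z] commute with this quotient, which is [1 + d (p n)^-1]. As [d] is real
   and nonzero, [z] then commutes with [p n], hence with [u]. *)
have c1 : GRing.comm z (p m * (p n)^-1).
  by rewrite /GRing.comm mulrA zpm -!mulrA mulrV // mulr1.
move: c1; rewrite pmn mulrDl mulrV // => c1.
have c2 : GRing.comm z (d * (p n)^-1).
  by rewrite -(addrK 1 (d * _)); apply: commrB => //; exact: commr1.
have c3 : GRing.comm z (p n)^-1.
  rewrite -(mulKr (d0 : d \is a GRing.unit) (p n)^-1).
  by apply: commrM => //; apply: commrV.
have c4 : GRing.comm z (p n) by rewrite -(invrK (p n)); exact: commrV.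
rewrite -(addKr (quat_of_real n%:R) u) -/(p n).
apply: commrD => //; apply: commrN; apply: commr_sym; exact: quat_of_real_comm.
Qed.

(** * Infinitely many sample sets *)

Theorem proposition3p12 (R : realType) (N : nat) (a b : nat -> quat R)
    (h1 h2 s : quat R) (F : 'I_N -> quat R)
    (N_gt0 : (0 < N)%N)
    (b_neq0 : forall k, (k <= N)%N -> b k != 0)
    (L_normal : normal_op (@Lop R N a b h1 h2))
    (s_neq0 : s != 0)
    (sph : exists z0, spherical_zero (fun lam => pN N a b h1 h2 lam s) z0) :
  infinite_set (sample_sets N a b h1 s (f_s a b h1 F s)).
Proof.
have [z0 [z0_nonreal z0_root]] := sph.
have [f f_inj f_theta] := theta_nat_inj z0 z0_nonreal => fin.
(* Finitely many sample sets, each finite, would have a finite union, yet this union contains the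
   infinite range of [f]. *)
have : finite_set
    (\bigcup_(A in sample_sets N a b h1 s (f_s a b h1 F s)) A)%classic.
  by apply: bigcup_finite => // _ [lams _ <-]; exact: finite_image.
apply: (sub_infinite_set (A := range f)); last first.
  have f_inj' : {in f @^-1` range f &, injective f}%classic.
    by move=> m n _ _ /f_inj.
  move=> /(finite_preimage f_inj') fpre; apply: infinite_nat.
  by apply: sub_finite_set fpre => n _; exists n.
move=> _ [n _ <-].
have NN : (0 < N <= N)%N by rewrite N_gt0 leqnn.
have [lams [lams0 uo _]] := eigenfamily_extension a b h1 h2 s N_gt0 b_neq0
  s_neq0 (f n) N L_normal (z0_root _ (f_theta n)) NN.
exists (range (fun k : 'I_N => lams k)).
  by exists (fun k : 'I_N => lams k) => //; exact: sampling_of_orthogonal.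
(* The orbit point [f n] is the sample point of index 0. *)
by exists (Ordinal N_gt0).
Qed.
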